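(* Let $U\in\mathcal{P}(n,d)$ and let $L^{tr}=\mathbf{e}^d\mathbf{n}^{n-d}\in\mathcal{P}(n,d)$. Let $\Lambda=\Lambda_{M[U,L^{tr}]}$. Then $\mathrm{st}_{L^{tr}}(C)=\Lambda(\mathcal{E}(C))$ for all $C\in\mathcal{P}[U,L^{tr}]$. In particular, \[ \mathcal{S}_{\mathsf{lex}}(M[U,L^{tr}])=\{\mathrm{st}_{L^{tr}}(C) : C\in\mathcal{P}[U,L^{tr}]\}. \]
   Context: $\mathcal{P}(n,d)$ is the set of words $C=C_1\cdots C_n$ in letters $\mathbf{e}$ (east step $(1,0)$) and $\mathbf{n}$ (north step $(0,1)$) with exactly $d$ letters $\mathbf{e}$ (lattice paths from $(0,0)$ to $(d,n-d)$). $\mathcal{E}(C)=\{i\in[n]:C_i=\mathbf{e}\}$. For $U,L\in\mathcal{P}(n,d)$, $U$ is weakly above $L$ if every prefix $L_1\cdots L_k$ contains at least as many $\mathbf{e}$'s as $U_1\cdots U_k$. $\mathcal{P}[U,L]$ is the set of $C\in\mathcal{P}(n,d)$ weakly below $U$ and weakly above $L$, and the lattice path matroid $M[U,L]$ is the matroid on $[n]$ with set of bases $\{\mathcal{E}(C):C\in\mathcal{P}[U,L]\}$. Statistic: for $C\in\mathcal{P}(n,d)$ scan positions from left to right and mark position $i$ with $C_i=\mathbf{e}$ if the number of $j<i$ with $C_j=\mathbf{n}$ equals the number of $j<i$ with $C_j=\mathbf{e}$ that are unmarked. Then $\mathrm{st}_{L^{tr}}(C)\subseteq\mathcal{E}(C)$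 is the set of unmarked positions $i$ with $C_i=\mathbf{e}$. For a matroid $M$ on finite $E\subset\mathbb{N}$ with bases $\mathcal{B}(M)$: $\mathcal{S}_{\mathsf{lex}}(M)=\{\tau\subseteq E:\prod_{i\in\tau}x_i\notin\mathrm{in}(I(V_M))\}$, where $V_M=\{\mathbf{e}_B:B\in\mathcal{B}(M)\}$ (characteristic vectors), $I(V_M)\subseteq\mathbb{R}[x_e:e\in E]$ is its vanishing ideal and the initial ideal is taken for the lexicographic order with $x_e\succ x_f$ for $e<f$ ($\mathcal{S}_{\mathsf{lex}}=\{\emptyset\}$ if $E=\emptyset$). There is a unique family of bijections $\Lambda_M:\mathcal{B}(M)\to\mathcal{S}_{\mathsf{lex}}(M)$, indexed by all matroids $M$ with ground set a finite subset of $\mathbb{N}$, such that for $M$ with nonempty ground set, $m$ its largest element, and $B\in\mathcal{B}(M)$: $\Lambda_M(B)\subseteq B$; $\Lambda_M(B)=\Lambda_{M\backslash m}(B)$ if $m\notin B$; $\Lambda_M(B)\setminus\{m\}=\Lambda_{M/m}(B\setminus\{m\})$ if $m\in B$. $\Lambda_{M[U,L]}$ refers to this family. *)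

(* Defs.v *)
From HB Require Import structures.
From mathcomp Require Import all_boot all_order all_algebra.
From mathcomp Require Import finmap.
From mathcomp Require Import mpoly.
From mathcomp Require Import reals.

Unset Strict Implicit.
Unset Printing Implicit Defensive.

Import GRing.Theory.
Local Open Scope fset_scope.

(* A word C = C_1 ... C_n in letters e, n is encoded as a seq bool:     *)
(* true = e (east step), false = n (north step).                         *)

Definition path_word := seq bool.

Definition inP (n d : nat) (C : path_word) : bool :=
  (size C == n) && (count id C == d).

Definition Eset (C : path_word) : {fset nat} :=
  [fset i.+1 | i in [seq i <- iota 0 (size C) | nth false C i]].

Definition ne (C : path_word) (k : nat) : nat := count id (take k C).

(* U weakly above L: every prefix of L has at least as many e's as the
   prefix of U of the same length.  (Prefix lengths k beyond both sizes
   give the whole words, so it suffices to check k <= max sizes.) *)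
Definition weakly_above (U L : path_word) : bool :=
  all (fun k => ne U k <= ne L k) (iota 0 (maxn (size U) (size L)).+1).

Definition inPUL (n d : nat) (U L C : path_word) : bool :=
  [&& inP n d C, weakly_above U C & weakly_above C L].

Definition Ltr (n d : nat) : path_word := nseq d true ++ nseq (n - d) false.

Definition words (n : nat) : seq path_word := [seq val t | t : n.-tuple bool].

Definition ground (n : nat) : {fset nat} := [fset i.+1 | i in iota 0 n].

Definition LPM_bases (n d : nat) (U L : path_word) : {fset {fset nat}} :=
  [fset Eset C | C in [seq C <- words n | inPUL n d U L C]].

(* scan positions left to right; position i with C_i = e is marked iff  *)
(* #{j < i : C_j = n} = #{j < i : C_j = e, j unmarked}.                  *)
(* nN = number of n's so far, nU = number of unmarked e's so far.        *)

Fixpoint st_aux (C : path_word) (i nN nU : nat) : seq nat :=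
  match C with
  | [::] => [::]
  | c :: C' =>
      if c then
        if nN == nU then st_aux C' i.+1 nN nU
        else i :: st_aux C' i.+1 nN nU.+1
      else st_aux C' i.+1 nN.+1 nU
  end.

Definition st_Ltr (C : path_word) : {fset nat} := [fset x | x in st_aux C 1 0 0].

Definition is_matroid (E : {fset nat}) (Bs : {fset {fset nat}}) : Prop :=
  [/\ Bs != fset0,
      (forall B, B \in Bs -> B `<=` E) &
      (forall B1 B2 x, B1 \in Bs -> B2 \in Bs -> x \in B1 `\` B2 ->
         exists2 y, y \in B2 `\` B1 & y |` (B1 `\ x) \in Bs)].

Definition del_bases (Bs : {fset {fset nat}}) (m : nat) : {fset {fset nat}} :=
  if [forall B : Bs, m \in val B]
  then [fset B `\ m | B in Bs]
  else [fset B in Bs | m \notin B].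

Definition con_bases (Bs : {fset {fset nat}}) (m : nat) : {fset {fset nat}} :=
  if [forall B : Bs, m \notin val B]
  then Bs
  else [fset B `\ m | B in [fset B in Bs | m \in B]].

Definition fmax (E : {fset nat}) : nat := \max_(i <- E) i.

(* The ring R[x_e : e in E] is {mpoly R[#|E|]}, variable i standing for *)
(* the i-th smallest element of E; thus x_e > x_f for e < f means that  *)
(* variable i is larger than variable j for i < j.                      *)

Section Slex.
Variable R : realType.

Definition elts (E : {fset nat}) : seq nat := sort leq E.

Definition charvec (E : {fset nat}) (B : {fset nat}) : 'I_#|` E| -> R :=
  fun i => (((nth 0%N (elts E) i \in B) : nat)%:R)%R.

Definition vanishing (E : {fset nat}) (Bs : {fset {fset nat}})
    (f : {mpoly R[#|` E|]}) : Prop :=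
  forall B, B \in Bs -> (f.@[charvec E B] = 0)%R.

Definition lex_lt k (m1 m2 : 'X_{1..k}) : Prop :=
  exists i : 'I_k, (forall j : 'I_k, (j < i)%N -> m1 j = m2 j) /\ (m1 i < m2 i)%N.

Definition lex_lead k (f : {mpoly R[k]}) (m : 'X_{1..k}) : Prop :=
  m \in msupp f /\ (forall m', m' \in msupp f -> m' = m \/ lex_lt k m' m).

Definition in_initial (E : {fset nat}) (Bs : {fset {fset nat}})
    (p : {mpoly R[#|` E|]}) : Prop :=
  exists r : seq ({mpoly R[#|` E|]} * 'X_{1..#|` E|}),
    (forall q, q \in r -> exists f, [/\ vanishing E Bs f, (f != 0)%R & lex_lead #|` E| f q.2]) /\
    (p = \sum_(q <- r) q.1 * 'X_[q.2])%R.

Definition sqfree_mono (E : {fset nat}) (tau : {fset nat}) : 'X_{1..#|` E|} :=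
  [multinom ((nth 0%N (elts E) i \in tau) : nat) | i < #|` E|].

Definition S_lex (E : {fset nat}) (Bs : {fset {fset nat}}) (tau : {fset nat}) : Prop :=
  tau `<=` E /\ ~ in_initial E Bs 'X_[sqfree_mono E tau].

End Slex.

(* The family Lambda: a function Lam E Bs B standing for Lambda_M(B),   *)
(* M the matroid on E with bases Bs.                                    *)

Definition Lambda_spec (R : realType)
    (Lam : {fset nat} -> {fset {fset nat}} -> {fset nat} -> {fset nat}) : Prop :=
  forall E Bs, is_matroid E Bs ->
    [/\ (forall B, B \in Bs -> S_lex R E Bs (Lam E Bs B)),
        {in Bs &, injective (Lam E Bs)},
        (forall tau, S_lex R E Bs tau -> exists2 B, B \in Bs & Lam E Bs B = tau) &
        E != fset0 ->
        forall B, B \in Bs ->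
          [/\ Lam E Bs B `<=` B,
              fmax E \notin B ->
                Lam E Bs B = Lam (E `\ fmax E) (del_bases Bs (fmax E)) B &
              fmax E \in B ->
                Lam E Bs B `\ fmax E =
                Lam (E `\ fmax E) (con_bases Bs (fmax E)) (B `\ fmax E)]].

(* Main.v *)
Require Import Defs.
From HB Require Import structures.
From mathcomp Require Import all_boot all_order all_algebra.
From mathcomp Require Import finmap.
From mathcomp Require Import mpoly.
From mathcomp Require Import reals.

Set Implicit Arguments.
Unset Strict Implicit.
Unset Printing Implicit Defensive.

Import GRing.Theory.
Local Open Scope fset_scope.

(** A monomial is standard for the vanishing ideal of V in {0,1}^n iff its
    restriction to V is not a combination of lex-smaller squarefree monomials.
    Since the last variable is the smallest one, splitting V by its last
    coordinate gives the "lex game" recursion: t is standard for V iff it is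
    standard for one of the two slices, and t x_n iff t is standard for both.
    For lattice paths the slices are deletion and contraction of the last
    element.  Read [n] as an opening and [e] as a closing bracket: unmarked
    [e]'s are the matched ones.  A path C with an unmatched [n] can be turned
    into one with the same statistic and one more [e], by changing its first
    unmatched [n]; so the statistic obeys the same recursion.  The same flip
    together with injectivity of Lambda decides whether the last element
    belongs to Lambda(B). *)

(** Words are kept reversed, the head being the letter of the
    largest ground set element, so that recursion on words removes it. *)

Definition slice (b : bool) (V : pred (seq bool)) : pred (seq bool) :=
  fun w => V (b :: w).

Fixpoint standard (V : pred (seq bool)) (t : seq bool) : bool :=
  match t with
  | [::] => V [::]
  | true :: t' => standard (slice false V) t' && standard (slice true V) t'
  | false :: t' => standard (slice false V) t' || standard (slice true V) t'
  end.

(** Value at the 0/1 point [v] of the squarefree monomial with support [s]. *)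
Definition chi (s v : seq bool) : bool := all2 implb s v.

(** The head is the smallest variable, so tails are compared first and heads only break ties. *)
Fixpoint lex_word (s t : seq bool) : bool :=
  match s, t with
  | b :: s', c :: t' => lex_word s' t' || [&& s' == t', ~~ b & c]
  | _, _ => false
  end.

(** * Linear dependence of monomials on a set of 0/1 points *)

Section StandardWords.
Variable F : fieldType.
Implicit Types (V : pred (seq bool)) (l : seq (F * seq bool)).
Local Open Scope ring_scope.

Definition lincomb l (v : seq bool) : F :=
  \sum_(p <- l) p.1 * (chi p.2 v)%:R.

Definition nonstandard V t : Prop :=
  exists2 l, all (fun p => lex_word p.2 t) l &
    forall v, size v = size t -> V v -> (chi t v)%:R = lincomb l v.

Lemma lincomb_nil v : lincomb [::] v = 0.
Proof. by rewrite /lincomb big_nil. Qed.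

Lemma lincomb_cons p l v :
  lincomb (p :: l) v = p.1 * (chi p.2 v)%:R + lincomb l v.
Proof. by rewrite /lincomb big_cons. Qed.

Lemma lincomb_cat l1 l2 v :
  lincomb (l1 ++ l2) v = lincomb l1 v + lincomb l2 v.
Proof. by rewrite /lincomb big_cat. Qed.

Definition scale_word (a : F) (b : bool) (p : F * seq bool) :=
  (a * p.1, b :: p.2).

Lemma lincomb_scale a b l c v :
  lincomb (map (scale_word a b) l) (c :: v) = (b ==> c)%:R * a * lincomb l v.
Proof.
rewrite /lincomb big_map mulr_sumr; apply: eq_bigr => p _ /=.
by rewrite /chi /=; case: b; case: c; rewrite /= ?mul1r ?mul0r ?mulr0 ?mulrA.
Qed.

Lemma all_scale a b c l t :
  all (fun p => lex_word p.2 t) l ->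
  all (fun p => lex_word p.2 (c :: t)) (map (scale_word a b) l).
Proof.
by rewrite all_map; apply: sub_all => p /= ->.
Qed.

(** Only [false :: t] lies below [true :: t] without having its tail below [t]. It omits the head
    variable, so its coefficient [a] is the same on both slices. *)
Lemma lincomb_split t l :
  all (fun p => lex_word p.2 (true :: t)) l ->
  exists a l0 l1, [/\ all (fun p => lex_word p.2 t) l0,
    all (fun p => lex_word p.2 t) l1 &
    forall v, lincomb l (false :: v) = a * (chi t v)%:R + lincomb l0 v /\
              lincomb l (true :: v) = a * (chi t v)%:R + lincomb l1 v].
Proof.
elim: l => [_|[a [|b s]] l IH] //=.
  by exists 0, [::], [::]; split=> // v; rewrite !lincomb_nil mul0r addr0.
move=> /andP[hs /IH[a' [l0 [l1 [h0 h1 hv]]]]].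
case: (boolP (lex_word s t)) hs => [hst _|_ /= /and3P[/eqP-> hb _]].
  (* A monomial containing the head variable vanishes on the slice [false]; hence the factor
     [~~ b]. *)
  exists a', ((a * (~~ b)%:R, s) :: l0), ((a, s) :: l1); split=> /= [||v]; rewrite ?hst //.
  have [e0 e1] := hv v; rewrite !lincomb_cons e0 e1 /chi /=.
  by split; rewrite addrCA; congr (_ + (_ + _)); case: (b); rewrite /= ?mulr1 ?mulr0 ?mul0r.
exists (a + a'), l0, l1; split=> // v.
have [e0 e1] := hv v; rewrite !lincomb_cons e0 e1 /chi /= (negbTE hb) /=.
by rewrite mulrDl !addrA.
Qed.

(** No word below [false :: t] has tail [t], so no multiple of [chi t] is left over. *)
Lemma lincomb_split_false t l :
  all (fun p => lex_word p.2 (false :: t)) l ->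
  exists l0 l1, [/\ all (fun p => lex_word p.2 t) l0,
    all (fun p => lex_word p.2 t) l1 &
    forall v, lincomb l (false :: v) = lincomb l0 v /\
              lincomb l (true :: v) = lincomb l1 v].
Proof.
elim: l => [_|[a [|b s]] l IH] //=.
  by exists [::], [::]; split=> // v; rewrite !lincomb_nil.
rewrite !andbF orbF => /andP[hst /IH[l0 [l1 [h0 h1 hv]]]].
exists ((a * (~~ b)%:R, s) :: l0), ((a, s) :: l1); split=> /= [||v]; rewrite ?hst //.
have [e0 e1] := hv v; rewrite !lincomb_cons e0 e1 /chi /=.
by split; congr (_ + _); case: (b); rewrite /= ?mulr1 ?mulr0 ?mul0r.
Qed.

Lemma nonstandard_cons_false V t :
  nonstandard V (false :: t) <->
  nonstandard (slice false V) t /\ nonstandard (slice true V) t.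
Proof.
split=> [[l /lincomb_split_false[l0 [l1 [h0 h1 hv]]] hV]|].
  split; [exists l0|exists l1] => // v sv Vv; have [e0 e1] := hv v.
    by rewrite -e0 -hV //= sv.
  by rewrite -e1 -hV //= sv.
move=> [[l0 h0 hv0] [l1 h1 hv1]].
(* With x the head variable, this is f0 - x f0 + x f1, which interpolates between the two slices. *)
exists (map (scale_word 1 false) l0 ++
        map (scale_word (-1) true) l0 ++ map (scale_word 1 true) l1).
  by rewrite !all_cat !all_scale.
move=> [|c v] //= [sv] Vv; rewrite !lincomb_cat !lincomb_scale.
case: c Vv => Vv; rewrite /chi /= -/(chi t v) ?mulr1 ?mul1r ?mul0r ?addr0.
  by rewrite mulN1r addrA subrr add0r (hv1 v).
exact: hv0.
Qed.

Lemma nonstandard_cons_true V t :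
  nonstandard V (true :: t) <->
  nonstandard (slice false V) t \/ nonstandard (slice true V) t.
Proof.
split=> [[l /lincomb_split[a [l0 [l1 [h0 h1 hv]]]] hV]|].
  (* On the slice [false] the left side is 0, so a nonzero [a] lets one solve for [chi t] there. If
     [a] is 0, the slice [true] expresses [chi t] by [l1]. *)
  have [a0|a0] := eqVneq a 0.
    right; exists l1 => // v sv Vv; have [_] := hv v.
    by rewrite a0 mul0r add0r => <-; rewrite -hV //= sv.
  left; exists (map (fun p => (- a^-1 * p.1, p.2)) l0).
    by rewrite all_map.
  move=> v sv Vv; have [e _] := hv v.
  have : lincomb l (false :: v) = 0 by rewrite -hV //= sv.
  rewrite e => /eqP; rewrite addr_eq0 => /eqP e2.
  rewrite -[LHS](mulKf a0) e2 /lincomb big_map mulrN -mulNr mulr_sumr.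
  by apply: eq_bigr => p _ /=; rewrite mulrA.
case=> [[l0 h0 hv0]|[l1 h1 hv1]].
  (* This is x t = t - (1 - x) t, with t replaced by [l0] in the second term, where only x = 0
     matters. *)
  exists ((1, false :: t) :: map (scale_word (-1) false) l0 ++
          map (scale_word 1 true) l0).
    by rewrite /= eqxx orbT all_cat !all_scale.
  move=> [|c v] //= [sv] Vv; rewrite lincomb_cons lincomb_cat !lincomb_scale.
  case: c Vv => Vv; rewrite /chi /= -/(chi t v) !mul1r ?mulN1r ?mul0r.
    by rewrite addNr addr0.
  by rewrite addr0 (hv0 v) // subrr.
exists (map (scale_word 1 true) l1); first by rewrite all_scale.
move=> [|c v] //= [sv] Vv; rewrite !lincomb_scale.
case: c Vv => Vv; rewrite /chi /= -/(chi t v) ?mulr1 ?mul1r ?mul0r //.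
exact: hv1.
Qed.

(** Both recursions are the negated clauses of [standard]. For the empty word only the empty
    combination is available, so the constant 1 is nonstandard exactly when [V] misses the empty
    word. *)
Lemma nonstandardE V t : nonstandard V t <-> ~~ standard V t.
Proof.
elim: t V => [|[] t IH] V /=.
- split=> [[[|p l]]|hV]; last by exists [::] => // [[|//]] _ Vv; case/negP: hV.
    move=> _ /(_ [::] erefl) hv; apply/negP => /hv /eqP.
    by rewrite lincomb_nil oner_eq0.
  by case: p => [a [|]].
- rewrite negb_and; split.
    by case/nonstandard_cons_true => /IH ->; rewrite ?orbT.
  by move=> /orP[] /IH ?; apply/nonstandard_cons_true; [left|right].
- rewrite negb_or; split.
    by case/nonstandard_cons_false => /IH -> /IH ->.
  by move=> /andP[/IH ? /IH ?]; apply/nonstandard_cons_false.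
Qed.

End StandardWords.

(** * The statistic on reversed paths and its recursion *)

(** Indicator word of the unmarked positions. The tail is the path before the last letter, so both
    counts are those of the scan on reaching that letter. *)
Fixpoint st_word (w : seq bool) : seq bool :=
  match w with
  | [::] => [::]
  | b :: w' => (b && (count negb w' != count id (st_word w'))) :: st_word w'
  end.

Fixpoint dominates (u : nat -> nat) (w : seq bool) : bool :=
  match w with
  | [::] => u 0 <= 0
  | b :: w' => (u (size w) <= count id w) && dominates u w'
  end.

(** [u k] bounds from below the number of [e]'s among the first [k] letters; it will be [ne U]. One
    fixed [u] serves for all [n] and [d], which keeps the class closed under slices. *)
Definition paths (n d : nat) (u : nat -> nat) : pred (seq bool) :=
  fun w => [&& size w == n, count id w == d & dominates u w].

Lemma size_st_word w : size (st_word w) = size w.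
Proof. by elim: w => //= b w ->. Qed.

(** By induction the disequality tested in [st_word] is a strict inequality, so one more unmarked
    [e] preserves the bound. *)
Lemma count_st_word w : count id (st_word w) <= count negb w.
Proof.
elim: w => //= b w IH; case: b => /=; last by rewrite add0n leqW.
by rewrite add0n; case: eqP => [->|/eqP h] //=; rewrite add1n ltn_neqAle eq_sym h.
Qed.

Lemma count_negb w : count negb w = size w - count id w.
Proof. by rewrite -(count_predC id w) addKn. Qed.

(* The word w' changes the first unmatched [n] of w to a (marked) [e]. *)
Lemma flip_unmatched w :
  count negb w != count id (st_word w) ->
  exists w', [/\ st_word w' = st_word w, size w' = size w,
    count id w' = (count id w).+1 &
    forall u, dominates u w -> dominates u w'].
Proof.
elim: w => //= b w IH.
(* If nothing is unmatched in [w], the head must be the first unmatched [n]; turned into [e] it is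
   marked. Otherwise the flip happens inside [w]. *)
have [e|ne] := eqVneq (count negb w) (count id (st_word w)).
  case: b; rewrite /= ?e ?eqxx //= => _.
  exists (true :: w); rewrite /= e eqxx; split=> // u /andP[h ->].
  by rewrite andbT (leq_trans h) // leq_add2r.
have [w' [e1 e2 e3 e4]] := IH ne.
have hn : (count negb w').+1 = count negb w.
  have /(leq_ltn_trans (leq0n _)) : count id (st_word w) < count negb w.
    by rewrite ltn_neqAle eq_sym ne count_st_word.
  by rewrite !count_negb e2 e3 subn_gt0 => /subnSK.
(* If [b] is an [e], it uses up one unmatched [n] of [w], and [hb] says another one remains; so [b]
   stays unmarked after the flip. *)
move=> hb; exists (b :: w'); rewrite /= e1 e2 e3 addnS; split=> //.
  congr (_ :: _); case: b hb => //=; rewrite add0n add1n -hn eqSS => hb.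
  by rewrite hb.
by move=> u /andP[h /e4 ->]; rewrite andbT (leq_trans h).
Qed.

Lemma eq_standard V V' t : V =1 V' -> standard V t = standard V' t.
Proof.
elim: t V V' => [|b t IH] V V' e //=.
by case: b; rewrite !(IH _ _ (fun w => e (_ :: w))).
Qed.

Lemma standard0 V t : V =1 pred0 -> standard V t = false.
Proof.
elim: t V => [|b t IH] V e //=.
have e' c : slice c V =1 pred0 by move=> w; rewrite /slice e.
by case: b; rewrite !IH.
Qed.

(** The bound at the endpoint reads [u n.+1 <= d] for every word with [d] letters [e], so it does
    not depend on the path. *)
Lemma slice_false n d u : u n.+1 <= d ->
  slice false (paths n.+1 d u) =1 paths n d u.
Proof.
move=> h w; rewrite /slice /paths /= eqSS add0n.
by apply/and3P/and3P => [[-> -> /andP[]]|[/[dup]/eqP-> -> /[dup]/eqP-> -> ->]] //; rewrite h.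
Qed.

Lemma slice_true n d u : u n.+1 <= d.+1 ->
  slice true (paths n.+1 d.+1 u) =1 paths n d u.
Proof.
move=> h w; rewrite /slice /paths /= eqSS add1n eqSS.
by apply/and3P/and3P => [[-> -> /andP[]]|[/[dup]/eqP-> -> /[dup]/eqP-> -> ->]] //; rewrite h.
Qed.

Lemma slice_true0 n u : slice true (paths n 0 u) =1 pred0.
Proof. by move=> w; rewrite /slice /paths /= andbF. Qed.

Lemma paths_last n d u b w : paths n.+1 d u (b :: w) -> u n.+1 <= d.
Proof. by case/and3P => /eqP [<-] /eqP<- /andP[]. Qed.

(** The extra [e] gained by the flip compensates for the removed final [e]: the statistic of a path
    in the contraction slice also occurs in the deletion slice. *)
Lemma paths_flip n d u w :
  paths n.+1 d.+1 u (true :: w) -> count negb w != count id (st_word w) ->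
  exists2 w', paths n d.+1 u w' & st_word w' = st_word w.
Proof.
case/and3P; rewrite /= add1n => /eqP[sw] /eqP[cw] /andP[_ dw].
move=> /flip_unmatched[w' [e1 e2 e3 e4]]; exists w' => //.
by rewrite /paths e2 sw e3 cw !eqxx e4.
Qed.

(** The statistics of paths obey the recursion of [standard], with [paths_flip] linking the two
    slices. *)
Lemma standard_paths n d u t : size t = n ->
  standard (paths n d u) t <-> exists2 w, paths n d u w & st_word w = t.
Proof.
elim: n d t => [|n IH] d [|b t] //=.
  by split=> [h|[[|//] //]]; exists [::].
move=> [st]; have [h|h] := leqP (u n.+1) d; last first.
  have V0 : paths n.+1 d u =1 pred0.
    move=> w; apply/negP => /and3P[/eqP sw /eqP cw].
    by case: w sw cw => //= c w [->] -> /andP[]; rewrite leqNgt h.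
  have e c : standard (slice c (paths n.+1 d u)) t = false.
    by apply: standard0 => w; apply: V0.
  by rewrite !e; split=> [|[w]]; [case: b|rewrite V0].
rewrite !(eq_standard t (slice_false h)).
have P0 w : paths n d u w -> paths n.+1 d u (false :: w).
  by rewrite -(slice_false h).
have := IH d t st; case: d h P0 => [|d] h P0 IHd.
  rewrite (standard0 t (slice_true0 _ _)) andbF orbF.
  split=> [|[[|c w]]]; first case: b => // /IHd[w hw e].
    by exists (false :: w); [exact: P0|rewrite /= e].
  - by case/and3P.
  - case: c => [|hw /= [<- e]]; first by move: (slice_true0 n.+1 u w); rewrite /slice => ->.
    by apply/IHd; exists w; rewrite // -(slice_false h).
rewrite !(eq_standard t (slice_true h)).
have IH1 := IH d t st; have P1 w : paths n d u w -> paths n.+1 d.+1 u (true :: w).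
  by rewrite -(slice_true h).
split.
  case: b => [/andP[/IHd[w0 h0 e0] /IH1[w1 h1 e1]]|/orP[/IHd[w0 h0 e0]|/IH1[w1 h1 e1]]].
  (* [w1] has one [e] less and one [n] more than [w0] but the same statistic. Hence it has an
     unmatched [n], and the appended [e] is unmarked. *)
  - exists (true :: w1); rewrite ?P1 //= e1 -{1}e0; congr (_ :: _).
    rewrite neq_ltn; apply/orP; right.
    have := count_st_word w0; case/and3P: h0 h1 => /eqP s0 /eqP c0 _ /and3P[/eqP s1 /eqP c1 _].
    have : count id w0 <= size w0 by apply: count_size.
    rewrite !count_negb s0 s1 c0 c1 => hd; rewrite -(subnSK hd) ltnS //.
  - by exists (false :: w0); [exact: P0|rewrite /= e0].
  (* Without an unmatched [n], an appended [e] is marked; otherwise flip and append [n]. *)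
  - have [e|ne] := eqVneq (count negb w1) (count id (st_word w1)).
      by exists (true :: w1); [exact: P1|rewrite /= e eqxx e1].
    have [w' h' e'] := paths_flip (P1 _ h1) ne.
    by exists (false :: w'); [exact: P0|rewrite /= e' e1].
case=> [[|c w]]; first by case/and3P.
move=> hw /= [hb ht]; case: c hw hb => [hw hb|hw <-]; last first.
  by apply/orP; left; apply/IHd; exists w; rewrite // -(slice_false h).
have -> : standard (paths n d u) t.
  by apply/IH1; exists w; rewrite // -(slice_true h).
case: b hb => /= hb; last by rewrite orbT.
(* The final [e] is unmarked, so an [n] before it is unmatched and can be flipped to reach the
   deletion slice. *)
rewrite andbT; apply/IHd.
have [w' h' e'] := paths_flip hw hb.
by exists w'; rewrite // e'.
Qed.

(** * Words versus monomials and the lexicographic order *)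

Definition rword (n : nat) (f : nat -> bool) : seq bool := rev (mkseq f n).

Lemma size_rword n f : size (rword n f) = n.
Proof. by rewrite size_rev size_mkseq. Qed.

Lemma rwordS n f : rword n.+1 f = f n :: rword n f.
Proof. by rewrite /rword mkseqS rev_rcons. Qed.

Lemma nth_rword n f i : i < n -> nth false (rev (rword n f)) i = f i.
Proof. by move=> h; rewrite revK nth_mkseq. Qed.

Lemma eq_rword n f g : {in gtn n, f =1 g} -> rword n f = rword n g.
Proof.
move=> e; congr rev; apply/eq_in_map => i.
by rewrite mem_iota => /e.
Qed.

Lemma rword_nth s : rword (size s) (nth false (rev s)) = s.
Proof. by rewrite /rword -(size_rev s) mkseq_nth revK. Qed.

Lemma size_lex_word s t : lex_word s t -> size s = size t.
Proof.
elim: s t => [|b s IH] [|c t] //= /orP[/IH->//|/and3P[/eqP->]//].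
Qed.

(** Links the recursion from the smallest variable with the usual description by the first, most
    significant, difference. *)
Lemma lex_rwordP n f g :
  reflect (exists i, [/\ i < n, {in gtn i, f =1 g}, ~~ f i & g i])
          (lex_word (rword n f) (rword n g)).
Proof.
elim: n => [|n IH]; first by right=> -[i []].
rewrite !rwordS /=; apply: (iffP orP) => [[/IH[i [h1 h2 h3 h4]]|]|[i []]].
- by exists i; rewrite ltnS ltnW.
- case/and3P=> /eqP e fn gn; exists n; split=> // i hi.
  by rewrite -(nth_rword f hi) e nth_rword.
- rewrite ltnS leq_eqVlt => /orP[/eqP-> h2 -> ->|]; last by left; apply/IH; exists i.
  by right; rewrite (eq_rword h2) eqxx.
Qed.

Definition indicator (E B : {fset nat}) : seq bool :=
  rword #|` E| (fun i => nth 0 (elts E) i \in B).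

Section Monomials.
Variable k : nat.
Implicit Types (m : 'X_{1..k}) (s t v : seq bool).

(** Positive powers of a variable agree on 0/1 points, so only the support of a monomial matters
    there. *)
Definition support_word m : seq bool := rword k (fun i => 0 < nth 0 m i).

Definition word_mono s : 'X_{1..k} :=
  [multinom (nth false (rev s) i : nat) | i < k].

Lemma word_monoK s : size s = k -> support_word (word_mono s) = s.
Proof.
move=> sk; rewrite -[RHS]rword_nth sk; apply: eq_rword => i hi.
by rewrite -(mnm_nth _ _ (Ordinal hi)) mnmE lt0b.
Qed.

(** Before the first difference [m] agrees with a 0/1 vector, and at it [m] is 0 and [t] is 1;
    passing to the support changes neither. *)
Lemma lex_support m t : size t = k ->
  lex_lt k m (word_mono t) -> lex_word (support_word m) t.
Proof.
move=> st [i [he hl]]; rewrite -[t]rword_nth st; apply/lex_rwordP.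
exists i; move: hl; rewrite mnmE; case ti : nth; rewrite // ltnS leqn0 => mi.
split=> //; last by rewrite -mnm_nth -eqn0Ngt.
move=> j hj; have hjk := ltn_trans hj (ltn_ord i).
by have := he (Ordinal hjk) hj; rewrite mnmE (mnm_nth 0) /= => ->; rewrite lt0b.
Qed.

Lemma lex_word_mono s t : size t = k ->
  lex_word s t -> lex_lt k (word_mono s) (word_mono t).
Proof.
move=> st hst; have ss : size s = k by rewrite (size_lex_word hst).
move: hst; rewrite -[s in lex_word s]rword_nth -[t in lex_word _ t]rword_nth ss st.
case/lex_rwordP => i [hi he /negbTE si ti]; exists (Ordinal hi).
by split=> [j hj|]; rewrite !mnmE /= ?si ?ti // he.
Qed.

Lemma lex_lt_irr m : ~ lex_lt k m m.
Proof. by case=> i [_]; rewrite ltnn. Qed.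

Lemma lex_ltDr m1 m2 m : lex_lt k m1 m2 -> lex_lt k (m + m1)%MM (m + m2)%MM.
Proof.
case=> i [he hl]; exists i; split=> [j hj|]; rewrite !mnmDE.
  by rewrite he.
by rewrite ltn_add2l.
Qed.

Variable R : realType.
Local Open Scope ring_scope.

Definition word_point v : 'I_k -> R := fun i => (nth false (rev v) i)%:R.

Lemma chi_rword n f g :
  (chi (rword n f) (rword n g))%:R = \prod_(i < n) (f i ==> g i)%:R :> R.
Proof.
elim: n => [|n IH]; first by rewrite big_ord0.
by rewrite !rwordS big_ord_recr /= -IH -natrM mulnb andbC.
Qed.

Lemma meval_word m v : size v = k ->
  'X_[m].@[word_point v] = (chi (support_word m) v)%:R.
Proof.
move=> sv; rewrite mevalX -[v in RHS]rword_nth sv chi_rword.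
apply: eq_bigr => i _; rewrite /word_point (mnm_nth 0).
case: (nth 0%N m i) => [|a]; rewrite ?expr0 //=.
by case: nth; rewrite ?expr1n ?expr0n.
Qed.

(** On the points of [V] the equation f = 0 is solved for its leading monomial, and every other
    monomial is replaced by its support. *)
Lemma lead_nonstandard (V : pred (seq bool)) (f : {mpoly R[k]}) t :
  size t = k -> (forall v, size v = k -> V v -> f.@[word_point v] = 0) ->
  lex_lead R k f (word_mono t) -> nonstandard R V t.
Proof.
move=> st fV [tf ht]; set a := f@_(word_mono t).
have a0 : a != 0 by rewrite -mcoeff_msupp.
exists [seq (- a^-1 * f@_m, support_word m)
       | m <- [seq m <- msupp f | m != word_mono t]].
  apply/allP => p /mapP[m]; rewrite mem_filter => /andP[hm /ht[e|hl] ->].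
    by rewrite e eqxx in hm.
  exact: lex_support.
move=> v sv Vv; rewrite st in sv; apply: (mulfI a0).
have := fV v sv Vv; rewrite mevalE (bigD1_seq _ tf) ?msupp_uniq //=.
rewrite -mevalX meval_word // word_monoK // => /eqP; rewrite addr_eq0 => /eqP->.
rewrite /lincomb [in RHS]big_map big_filter mulr_sumr -sumrN; apply: eq_bigr => m _ /=.
by rewrite -mevalX meval_word // !mulNr mulrN !mulrA mulfV ?mul1r.
Qed.

Lemma nonstandard_lead (V : pred (seq bool)) t :
  size t = k -> nonstandard R V t ->
  exists f : {mpoly R[k]}, [/\ forall v, size v = k -> V v -> f.@[word_point v] = 0,
    f != 0 & lex_lead R k f (word_mono t)].
Proof.
move=> st [l hl hV].
pose g : {mpoly R[k]} := \sum_(p <- l) p.1 *: 'X_[word_mono p.2].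
have sg m : m \in msupp g -> lex_lt k m (word_mono t).
  rewrite /g; elim: l hl {hV g} => [|p l IH] /=; first by rewrite big_nil msupp0.
  case/andP=> hp /IH{}IH; rewrite big_cons => /msuppD_le; rewrite mem_cat => /orP[|//].
  by move=> /msuppZ_le; rewrite msuppX inE => /eqP->; apply: lex_word_mono.
(* All monomials of [g] are smaller than that of [t], so nothing cancels the leading term. *)
have gt : g@_(word_mono t) = 0.
  by apply/eqP; rewrite mcoeff_eq0; apply/negP => /sg /lex_lt_irr.
have ft : ('X_[word_mono t] - g)@_(word_mono t) = 1.
  by rewrite mcoeffB gt subr0 mcoeffX eqxx.
exists ('X_[word_mono t] - g); split.
- move=> v sv Vv; rewrite mevalB meval_word // word_monoK // hV ?st //.
  apply/eqP; rewrite subr_eq0; apply/eqP; rewrite /g raddf_sum /lincomb.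
  elim: (l) hl => [|p l' IH] /=; first by rewrite !big_nil.
  case/andP=> hp /IH e; rewrite !big_cons e mevalZ meval_word //.
  by rewrite word_monoK // (size_lex_word hp).
- by apply/eqP => e; move: ft; rewrite e mcoeff0 => /esym/eqP; rewrite oner_eq0.
split=> [|m]; first by rewrite mcoeff_msupp ft oner_neq0.
by move=> /msuppB_le; rewrite mem_cat msuppX inE => /orP[/eqP->|/sg]; [left|right].
Qed.

End Monomials.

(** * From the initial ideal to standard words *)

Definition indicators (E : {fset nat}) (Bs : {fset {fset nat}}) : pred (seq bool) :=
  fun w => has (fun B => indicator E B == w) Bs.

Lemma sqfree_monoE E tau : sqfree_mono E tau = word_mono #|` E| (indicator E tau).
Proof. by apply/mnmP => i; rewrite !mnmE nth_rword. Qed.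

Section Initial.
Variable R : realType.
Local Open Scope ring_scope.

Lemma vanishing_indicators E Bs (f : {mpoly R[#|` E|]}) :
  vanishing R E Bs f <->
  (forall v, size v = #|` E| -> indicators E Bs v -> f.@[word_point R v] = 0).
Proof.
have e B : f.@[charvec R E B] = f.@[word_point R (indicator E B)].
  by rewrite !mevalE; apply: eq_bigr => m _; congr (_ * _);
    apply: eq_bigr => i _; rewrite /word_point nth_rword.
split=> [h v _ /hasP[B hB /eqP <-]|h B hB]; first by rewrite -e h.
by rewrite e h ?size_rword //; apply/hasP; exists B.
Qed.

Lemma in_initial_nonstandard E Bs tau :
  in_initial R E Bs 'X_[sqfree_mono E tau] <->
  nonstandard R (indicators E Bs) (indicator E tau).
Proof.
rewrite sqfree_monoE; set t := indicator E tau.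
have st : size t = #|` E| by rewrite size_rword.
split=> [[r [hr er]]|/(nonstandard_lead st)[f [fV f0 fl]]]; last first.
  exists [:: (1, word_mono #|` E| t)]; rewrite big_seq1 mul1r; split=> // q.
  by rewrite inE => /eqP->; exists f; split=> //; apply/vanishing_indicators.
have : word_mono #|` E| t \in msupp ('X_[word_mono #|` E| t] : {mpoly R[#|` E|]}).
  by rewrite msuppX inE.
rewrite er => {er}.
(* The monomial of [t] occurs in some summand, so it is a multiple of the generator [q.2]. *)
move=> /msupp_sum_le /flatten_mapP[q].
rewrite mem_filter /= => qr; rewrite (perm_mem (msuppMX _ _)) => /mapP[m _].
rewrite addmC => hm.
have [f [fV f0 [fl fm]]] := hr q qr.
(* Multiplied by the cofactor, [f] still vanishes on the points and now leads with the monomial of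
   [t]. *)
apply: (lead_nonstandard (f := f * 'X_[m]) st).
  move=> v sv Vv; rewrite mevalM; move/vanishing_indicators: fV => ->//.
  by rewrite mul0r.
split=> [|m']; rewrite (perm_mem (msuppMX _ _)).
  by rewrite hm; apply: map_f.
case/mapP=> m'' /fm[->|h] ->; first by left.
by right; rewrite hm; apply: lex_ltDr.
Qed.

End Initial.

Lemma S_lexE (R : realType) E Bs tau :
  S_lex R E Bs tau <-> tau `<=` E /\ standard (indicators E Bs) (indicator E tau).
Proof.
rewrite /S_lex; split=> -[-> h]; split=> //.
  by apply: contraT => /(nonstandardE R) /in_initial_nonstandard.
by move=> /in_initial_nonstandard /nonstandardE; rewrite h.
Qed.

(** * Words of length n versus subsets of [n] *)

Definition eset (w : seq bool) : {fset nat} := Eset (rev w).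

Lemma mem_Eset C x : (x \in Eset C) = (0 < x <= size C) && nth false C x.-1.
Proof.
apply/imfsetP/andP => /= [[i]|[/andP[]]].
  by rewrite mem_filter mem_iota => /andP[h hi] ->.
case: x => // x _ hx hn; exists x => //=.
by rewrite mem_filter mem_iota hn.
Qed.

Lemma eset_cons b w :
  eset (b :: w) = if b then (size w).+1 |` eset w else eset w.
Proof.
apply/fsetP => x; have e : (x \in eset (b :: w)) = (b && (x == (size w).+1)) || (x \in eset w).
  rewrite /eset !mem_Eset rev_cons size_rcons nth_rcons size_rev.
  case: x => [|x] /=; first by rewrite andbF.
  rewrite eqSS ltnS leq_eqVlt; case: ltngtP => //= _; rewrite ?andbF ?orbF ?andbT //.
by rewrite e; case: (b); rewrite //= in_fset1U.
Qed.

Lemma eset_le w x : x \in eset w -> 0 < x <= size w.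
Proof. by rewrite /eset mem_Eset size_rev => /andP[]. Qed.

Lemma notin_eset w : (size w).+1 \notin eset w.
Proof. by apply/negP => /eset_le; rewrite ltnn. Qed.

Lemma mem_ground n x : (x \in ground n) = (0 < x <= n).
Proof.
apply/imfsetP/idP => /= [[i]|]; first by rewrite mem_iota => h ->.
by case: x => // x hx; exists x; rewrite // mem_iota.
Qed.

Lemma perm_ground n : perm_eq (ground n) (iota 1 n).
Proof.
apply: uniq_perm; rewrite ?iota_uniq ?fset_uniq // => x.
by rewrite mem_ground mem_iota add1n ltnS.
Qed.

Lemma card_ground n : #|` ground n| = n.
Proof. by rewrite (perm_size (perm_ground n)) size_iota. Qed.

Lemma elts_ground n : elts (ground n) = iota 1 n.
Proof.
apply: (sorted_eq leq_trans anti_leq); rewrite ?(sort_sorted leq_total) ?iota_sorted //.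
by rewrite (perm_trans _ (perm_ground n)) // perm_sort.
Qed.

Lemma indicator_ground n B :
  indicator (ground n) B = rword n (fun i => i.+1 \in B).
Proof.
rewrite /indicator card_ground; apply: eq_rword => i hi.
by rewrite elts_ground nth_iota.
Qed.

Lemma esetK n w : size w = n -> indicator (ground n) (eset w) = w.
Proof.
move=> <-; rewrite indicator_ground -[RHS]rword_nth; apply: eq_rword => i hi.
by rewrite /eset mem_Eset size_rev /= (hi : i < size w).
Qed.

Lemma indicatorK n B : B `<=` ground n -> eset (indicator (ground n) B) = B.
Proof.
move=> /fsubsetP hB; apply/fsetP => x.
rewrite /eset mem_Eset size_rev indicator_ground size_rword.
apply/andP/idP => [[/andP[x0 xn]]|xB].
  by rewrite nth_rword prednK.
have := hB x xB; rewrite mem_ground => /[dup] h /andP[x0 xn]; split=> //.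
by rewrite nth_rword prednK.
Qed.

Lemma eset_sub n w : size w = n -> eset w `<=` ground n.
Proof. by move=> <-; apply/fsubsetP => x /eset_le; rewrite mem_ground. Qed.

Lemma mem_words n w : (w \in words n) = (size w == n).
Proof.
apply/mapP/eqP => [[t _ ->]|sw]; first exact: size_tuple.
by subst n; exists (in_tuple w); rewrite ?mem_enum.
Qed.

Definition path_bases (n d : nat) (u : nat -> nat) : {fset {fset nat}} :=
  [fset eset w | w in [seq w <- words n | paths n d u w]].

Lemma path_basesP n d u B :
  reflect (exists2 w, paths n d u w & B = eset w) (B \in path_bases n d u).
Proof.
apply: (iffP (imfsetP _ _ _ _)) => /= -[w hw ->]; exists w => //.
  by move: hw; rewrite mem_filter => /andP[].
by rewrite mem_filter hw mem_words; case/and3P: hw.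
Qed.

Lemma size_paths n d u w : paths n d u w -> size w = n.
Proof. by case/and3P => /eqP. Qed.

Lemma mem_path_bases n d u w : size w = n ->
  (eset w \in path_bases n d u) = paths n d u w.
Proof.
move=> sw; apply/path_basesP/idP => [[w' hw' e]|hw]; last by exists w.
by rewrite -(esetK sw) e esetK // (size_paths hw').
Qed.

Lemma indicators_path_bases n d u :
  indicators (ground n) (path_bases n d u) =1 paths n d u.
Proof.
move=> w; apply/hasP/idP => [[B /path_basesP[w' hw' ->] /eqP <-]|hw].
  by rewrite esetK // (size_paths hw').
by exists (eset w); rewrite ?mem_path_bases ?esetK // (size_paths hw).
Qed.

Lemma S_lex_path_bases (R : realType) n d u tau :
  S_lex R (ground n) (path_bases n d u) tau <->
  exists2 w, paths n d u w & tau = eset (st_word w).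
Proof.
rewrite S_lexE (eq_standard _ (indicators_path_bases n d u)).
have sz : size (indicator (ground n) tau) = n by rewrite size_rword card_ground.
split=> [[ht /(standard_paths _ _ sz)[w hw e]]|[w hw ->]].
  by exists w; rewrite // e indicatorK.
have sw : size (st_word w) = n by rewrite size_st_word (size_paths hw).
split; first exact: eset_sub.
by rewrite esetK //; apply/standard_paths => //; exists w.
Qed.

(** * Statistic and path conditions in terms of reversed words *)

(** [st_aux] scans forward with counters while [st_word] recurses on the last letter. After [C] the
    counters have grown by its number of [n]'s and by the number of positions listed. *)
Lemma st_aux_rcons C c i a b :
  st_aux (rcons C c) i a b = st_aux C i a b ++
    (if c && (a + count negb C != b + size (st_aux C i a b))%N
     then [:: (i + size C)%N] else [::]).
Proof.
elim: C i a b => [|c' C IH] i a b /=; first by rewrite !addn0; case: c; case: eqP.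
case: c' => /=; last by rewrite IH add1n !addSnnS.
by case: eqP => _ /=; rewrite IH add0n !addSnnS.
Qed.

Lemma st_Ltr_rev w : st_Ltr (rev w) = eset (st_word w).
Proof.
(* The size is carried along because the marking test for the next letter compares against it. *)
suff [_ h] : size (st_aux (rev w) 1 0 0) = count id (st_word w) /\
    st_aux (rev w) 1 0 0 =i eset (st_word w).
  by apply/fsetP => x; rewrite /st_Ltr in_fset h.
elim: w => [|b w [IHs IHm]]; first by split=> // x; rewrite /eset mem_Eset; case: x.
rewrite rev_cons st_aux_rcons eset_cons /= IHs count_rev size_rev !add0n add1n size_st_word.
case: ifP => _; split=> [|x]; rewrite ?size_cat ?IHs ?mem_cat ?IHm ?addn0 ?orbF //=.
  by rewrite addnC.
by rewrite in_fset1U orbC inE.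
Qed.

Lemma dominatesP u w :
  reflect (forall k, k <= size w -> u k <= ne (rev w) k) (dominates u w).
Proof.
elim: w => [|b w IH] /=.
  apply: (iffP idP) => [h k|/(_ 0 isT)//].
  by rewrite leqn0 => /eqP->.
have e k : k <= size w -> ne (rev (b :: w)) k = ne (rev w) k.
  by move=> hk; rewrite /ne rev_cons -cats1 takel_cat // size_rev.
have e' : ne (rev (b :: w)) (size w).+1 = (b + count id w)%N.
  by rewrite /ne take_oversize ?size_rev // count_rev.
apply: (iffP andP) => [[h1 /IH h2] k|h].
  by rewrite leq_eqVlt ltnS => /orP[/eqP->|hk]; rewrite ?e' ?e ?h2.
split; first by rewrite -e' h.
by apply/IH => k hk; rewrite -e // h // ltnW.
Qed.

Lemma inPUL_paths n d U C : inP n d U ->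
  inPUL n d U (Ltr n d) C = paths n d (ne U) (rev C).
Proof.
case/andP=> /eqP sU /eqP cU; rewrite /inPUL /paths size_rev count_rev /inP -andbA.
case: eqP => //= sC; case: eqP => //= cC.
have dn : d <= n by rewrite -cU -sU count_size.
(* A prefix of [Ltr n d] of length [k] has min(k, d) letters [e], the largest number possible. *)
have -> : weakly_above C (Ltr n d).
  apply/allP => k _; rewrite /ne /Ltr take_cat size_nseq.
  case: ltnP => hk.
    rewrite take_nseq ?(ltnW hk) // count_nseq mul1n.
    by rewrite (leq_trans (count_size _ _)) // size_take_min geq_minl.
  have hC : count id (take k C) <= count id C.
    by rewrite -{2}(cat_take_drop k C) count_cat leq_addr.
  by rewrite count_cat count_nseq mul1n -cC (leq_trans hC) ?leq_addr.
rewrite andbT /weakly_above sU sC maxnn; apply/allP/dominatesP => h k.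
  by rewrite size_rev sC revK => hk; apply: h; rewrite mem_iota.
by rewrite mem_iota => hk; have := h k; rewrite size_rev sC revK; apply.
Qed.

Lemma LPM_path_bases n d U : inP n d U ->
  LPM_bases n d U (Ltr n d) = path_bases n d (ne U).
Proof.
move=> hU; apply/fsetP => B; apply/imfsetP/path_basesP => /= -[C].
  by rewrite mem_filter inPUL_paths // => /andP[hC _] ->; exists (rev C); rewrite // /eset revK.
move=> hC ->; exists (rev C) => //.
rewrite mem_filter inPUL_paths // revK hC mem_words size_rev.
by rewrite (size_paths hC) eqxx.
Qed.

(** * The exchange axiom for the sets of east steps *)

Definition upto (k : nat) (B : {fset nat}) : {fset nat} :=
  [fset x in B | x <= k].

Lemma mem_upto k B x : (x \in upto k B) = (x \in B) && (x <= k).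
Proof. by rewrite !inE. Qed.

Lemma count_rword k B : 0 \notin B ->
  count id (rword k (fun i => i.+1 \in B)) = #|` upto k B|.
Proof.
move=> B0; elim: k => [|k IH].
  apply/esym/eqP; rewrite cardfs_eq0; apply/eqP/fsetP => x.
  rewrite mem_upto leqn0 in_fset0; apply/negP => /andP[/[swap] /eqP->].
  exact/negP.
rewrite rwordS /= IH.
have [hk|hk] := boolP (k.+1 \in B).
  suff -> : upto k.+1 B = k.+1 |` upto k B by rewrite cardfsU1 mem_upto ltnn andbF.
  apply/fsetP => x; rewrite in_fset1U !mem_upto leq_eqVlt ltnS.
  by case: eqP => [->|]; rewrite ?hk.
congr #|` _|; apply/fsetP => x; rewrite !mem_upto [in RHS]leq_eqVlt ltnS.
by case: eqP => [->|] //=; rewrite (negbTE hk).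
Qed.

(** A description by cardinalities of initial segments, in which exchanging two elements is easy to
    follow. *)
Lemma path_bases_card n d u B :
  B \in path_bases n d u <->
  [/\ B `<=` ground n, #|` B| = d & forall k, k <= n -> u k <= #|` upto k B|].
Proof.
suff h : B `<=` ground n -> (B \in path_bases n d u) <->
    (#|` B| = d /\ forall k, k <= n -> u k <= #|` upto k B|).
  split=> [hB|[hs hc hu]]; last by apply/h.
  have hs : B `<=` ground n.
    by case/path_basesP: hB => w /size_paths sw ->; apply: eset_sub.
  by have [] := (h hs).1 hB.
move=> /[dup] hs /fsubsetP hB.
have B0 : 0 \notin B by apply/negP => /hB; rewrite mem_ground.
have Bn : upto n B = B.
  apply/fsetP => x; rewrite mem_upto; case xB : (x \in B) => //=.
  by have := hB x xB; rewrite mem_ground => /andP[].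
rewrite -{1}(indicatorK hs) mem_path_bases ?size_rword ?card_ground //.
rewrite indicator_ground /paths size_rword eqxx count_rword // Bn /=.
have hne k : k <= n -> ne (rev (rword n (fun i => i.+1 \in B))) k = #|` upto k B|.
  move=> hk; rewrite -count_rword // /ne revK -map_take take_iota (minn_idPl hk).
  by rewrite count_rev.
split=> [/andP[/eqP-> /dominatesP]|[-> hu]].
  rewrite size_rword => hu; split=> // k hk.
  by rewrite -hne // hu.
rewrite eqxx; apply/dominatesP; rewrite size_rword => k hk.
by rewrite hne // hu.
Qed.

Lemma path_bases_matroid n d u w : paths n d u w ->
  is_matroid (ground n) (path_bases n d u).
Proof.
move=> hw; split.
- by apply/fset0Pn; exists (eset w); apply/path_basesP; exists w.
- by move=> B /path_bases_card[].
move=> B1 B2 x /path_bases_card[/fsubsetP s1 c1 u1] /path_bases_card[/fsubsetP s2 c2 u2].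
rewrite in_fsetD => /andP[xB2 xB1].
have /fset0Pn ex : B2 `\` B1 != fset0.
  apply/negP; rewrite fsetD_eq0 => h12.
  have /eqP e : B2 == B1 by rewrite eqEfcard h12 c1 c2 leqnn.
  by rewrite e xB1 in xB2.
(* The smallest candidate [y] is brought in, the best choice for the lower bounds on initial
   segments. *)
have [y yB ymin] := ex_minnP ex.
exists y => //; move: yB; rewrite in_fsetD => /andP[yB1 yB2].
apply/path_bases_card; split.
- apply/fsubsetP => z; rewrite in_fset1U in_fsetD1 => /orP[/eqP->|/andP[_]]; [exact: s2|exact: s1].
- rewrite cardfsU1 in_fsetD1 (negbTE yB1) andbF /= -c1.
  by rewrite (cardfsD1 x B1) xB1.
(* From [y] on, the new element makes up for the possible loss of [x]. Before [y], all elements of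
   [B2] lie in [B1] and differ from [x], so the bound for [B2] applies. *)
move=> k hk; have [hyk|hky] := leqP y k.
  apply: (leq_trans (u1 k hk)).
  have -> : upto k (y |` (B1 `\ x)) = y |` (upto k B1 `\ x).
    apply/fsetP => z; rewrite !(mem_upto, in_fset1U, in_fsetD1) andb_orl andbA.
    by case: eqP => // ->; rewrite hyk.
  rewrite cardfsU1 !(mem_upto, in_fsetD1) (negbTE yB1) !andbF (cardfsD1 x (upto k B1)).
  by rewrite leq_add2r leq_b1.
apply: (leq_trans (u2 k hk)); apply: fsubset_leq_card; apply/fsubsetP => z.
rewrite !(mem_upto, in_fset1U, in_fsetD1) => /andP[zB2 zk]; rewrite zk andbT.
apply/orP; right; apply/andP; split; first by apply: contraNneq xB2 => <-.
apply: contraT => zB1; have := ymin z; rewrite in_fsetD zB1 zB2 => /(_ isT).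
by rewrite leqNgt (leq_ltn_trans zk hky).
Qed.

(** * Deletion, contraction and the family Lambda *)

Lemma fmax_ground n : fmax (ground n.+1) = n.+1.
Proof.
apply/eqP; rewrite eqn_leq; apply/andP; split.
  apply/bigmax_leqP_seq => x; rewrite mem_ground => /andP[] //.
apply: (@leq_bigmax_seq _ _ _ (fun i => i)) => //; by rewrite mem_ground /=.
Qed.

Lemma ground_last n : ground n.+1 `\ n.+1 = ground n.
Proof.
apply/fsetP => x; rewrite in_fsetD1 !mem_ground (leq_eqVlt x n.+1) ltnS.
by case: eqP => [->|_] //=; rewrite ltnn.
Qed.

Lemma eset_inj w w' : size w = size w' -> eset w = eset w' -> w = w'.
Proof. by move=> s e; rewrite -(esetK (erefl (size w))) e s esetK. Qed.

Lemma eset_consD1 n b w : size w = n -> eset (b :: w) `\ n.+1 = eset w.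
Proof.
move=> <-; rewrite eset_cons; case: b; first by rewrite fsetU1K // notin_eset.
by apply/mem_fsetD1/notin_eset.
Qed.

Lemma mem_eset_cons n b w : size w = n -> (n.+1 \in eset (b :: w)) = b.
Proof.
by move=> <-; rewrite eset_cons; case: b; rewrite ?fset1U1 // (negbTE (notin_eset w)).
Qed.

(** The given path ending in [n] shows that the last element is not a coloop, which selects the
    ordinary branch of [del_bases]. *)
Lemma del_path_bases n d u w : paths n.+1 d u (false :: w) ->
  del_bases (path_bases n.+1 d u) n.+1 = path_bases n d u.
Proof.
move=> hw; have un := paths_last hw; rewrite /del_bases.
have [sw] := size_paths hw.
case: ifP => [/forallP|_].
  have hB : eset (false :: w) \in path_bases n.+1 d u by apply/path_basesP; exists (false :: w).
  by move=> /(_ [` hB]); rewrite /= mem_eset_cons.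
apply/fsetP => B; rewrite !inE /=; apply/andP/path_basesP.
  case=> /path_basesP[[|b w'] /[dup] hw' /size_paths // [sw'] ->].
  rewrite (mem_eset_cons _ sw') => /negbTE hb.
  exists w'; last by rewrite eset_cons hb.
  by rewrite hb in hw'; rewrite -(slice_false un).
case=> w' hw' ->; rewrite -{2}(size_paths hw') notin_eset; split=> //.
apply/path_basesP; exists (false :: w'); last by rewrite eset_cons.
by move: hw'; rewrite -(slice_false un).
Qed.

(** The given path ending in [e] shows that the last element is not a loop. *)
Lemma con_path_bases n d u w : paths n.+1 d.+1 u (true :: w) ->
  con_bases (path_bases n.+1 d.+1 u) n.+1 = path_bases n d u.
Proof.
move=> hw; have un := paths_last hw; rewrite /con_bases.
have [sw] := size_paths hw.
case: ifP => [/forallP|_].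
  have hB : eset (true :: w) \in path_bases n.+1 d.+1 u by apply/path_basesP; exists (true :: w).
  by move=> /(_ [` hB]); rewrite /= mem_eset_cons.
apply/fsetP => B; apply/imfsetP/path_basesP => /= -[].
  move=> B'; rewrite !inE /= => /andP[/path_basesP[[|b w'] /[dup] hw' /size_paths // [sw'] ->]].
  rewrite (mem_eset_cons _ sw') => hb ->; exists w'.
    by rewrite hb in hw'; rewrite -(slice_true un).
  by rewrite eset_consD1.
move=> w' hw' ->; exists (eset (true :: w')); last by rewrite eset_consD1 // (size_paths hw').
rewrite !inE mem_eset_cons ?(size_paths hw') // andbT.
apply/path_basesP; exists (true :: w') => //.
by move: hw'; rewrite -(slice_true un).
Qed.

(** Induction on [n]. The recursion of [Lam] settles paths ending in [n]; for those ending in [e] it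
    leaves open only whether the last element belongs to the value. *)
Lemma Lambda_eset (R : realType) Lam n d u w :
  Lambda_spec R Lam -> paths n d u w ->
  Lam (ground n) (path_bases n d u) (eset w) = eset (st_word w).
Proof.
move=> hL; elim: n d w => [|n IH] d w hw.
  have [hS _ _ _] := hL _ _ (path_bases_matroid hw).
  have hB : eset w \in path_bases 0 d u by apply/path_basesP; exists w.
  have /S_lex_path_bases[w' hw' ->] := hS _ hB.
  by rewrite (size0nil (size_paths hw)) (size0nil (size_paths hw')).
have [hS hinj _ hrec] := hL _ _ (path_bases_matroid hw).
have /hrec {}hrec : ground n.+1 != fset0.
  by apply/fset0Pn; exists n.+1; rewrite mem_ground /=.
have hBP w' : paths n.+1 d u w' -> eset w' \in path_bases n.+1 d u.
  by move=> h; apply/path_basesP; exists w'.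
have hF w' : paths n.+1 d u (false :: w') ->
    Lam (ground n.+1) (path_bases n.+1 d u) (eset (false :: w')) = eset (st_word (false :: w')).
  move=> h; have un := paths_last h; have [sw] := size_paths h.
  have [_ + _] := hrec _ (hBP _ h).
  rewrite fmax_ground (mem_eset_cons _ sw) => /(_ isT) ->.
  rewrite ground_last (del_path_bases h) !eset_cons IH //.
  by rewrite -(slice_false un).
case: w hw => [/size_paths//|[] w hw]; last exact: hF.
case: d hw hS hinj hrec hBP hF => [/and3P[]//|d] hw hS hinj hrec hBP hF.
have un := paths_last hw; have [sw] := size_paths hw.
have [_ _] := hrec _ (hBP _ hw).
rewrite fmax_ground (mem_eset_cons _ sw) => /(_ isT).
rewrite ground_last (con_path_bases hw) (eset_consD1 _ sw) IH; last by rewrite -(slice_true un).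
(* The value is lex standard, hence the statistic of some path; that path may differ from the given
   one. *)
have /S_lex_path_bases[z hz] := hS _ (hBP _ hw).
set T := Lam _ _ _ => eT; rewrite eT.
case: z hz eT => [/size_paths//|b z] hz eT.
have [sz] := size_paths hz; rewrite [st_word (b :: z)]/= eset_consD1 ?size_st_word //.
move=> /eset_inj; rewrite !size_st_word sz sw => /(_ erefl).
rewrite -/st_word => ez; rewrite /= ez; congr (eset (_ :: _)).
(* If the final [e] is marked but the value contained the last element, the other path would end in
   an unmarked [e]. Its tail [z] has as many [n]'s as [w] and the same statistic, a
   contradiction. *)
have [e|ne] := eqVneq (count negb w) (count id (st_word w)).
  apply/negP; case: b hz eT => //= hz _.
  have : count negb z = count negb w.
    case/and3P: hz => _ /eqP + _; case/and3P: hw => _ /eqP + _.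
    by rewrite /= !add1n !count_negb sz sw => -[->] [->].
  by rewrite -e => ->; rewrite eqxx.
(* If the final [e] is unmarked but the value omitted the last element, the flipped path followed by
   [n] would have the same value, against injectivity. *)
have [y hy ey] := paths_flip hw ne.
have hy' : paths n.+1 d.+1 u (false :: y) by move: hy; rewrite -(slice_false un).
apply/negPn/negP => hb.
have : eset (false :: y) = eset (true :: w).
  apply: hinj; rewrite ?hBP // hF // /= ey -/T eT /= ez.
  by rewrite (negbTE hb).
by move=> /eset_inj /=; rewrite (size_paths hy) sw => /(_ erefl).
Qed.

Theorem theorem4p4 (R : realType) (n d : nat) (U : path_word) :
  inP n d U ->
  let L := Ltr n d in
  let E := ground n in
  let Bs := LPM_bases n d U L in
  (forall Lam, Lambda_spec R Lam ->
     forall C, inPUL n d U L C -> st_Ltr C = Lam E Bs (Eset C)) /\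
  (forall tau, S_lex R E Bs tau <-> exists2 C, inPUL n d U L C & tau = st_Ltr C).
Proof.
move=> hU; rewrite /= LPM_path_bases //; split=> [Lam hL C|tau].
  rewrite inPUL_paths // => hC.
  by rewrite -[C]revK st_Ltr_rev -(Lambda_eset hL hC).
rewrite S_lex_path_bases; split=> [[w hw ->]|[C hC ->]].
  by exists (rev w); rewrite ?inPUL_paths ?revK ?st_Ltr_rev.
by exists (rev C); rewrite -?inPUL_paths // -st_Ltr_rev revK.
Qed.
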